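(* Let $G$ be a graph and let $a,b$ be distinct vertices of $G$. Let $H$ be the graph obtained from $G$ by adding two new vertices $c$ and $d$ and the edges $ac$, $bc$, $ad$, $bd$, and then removing the edge $ab$ if $ab\in E(G)$. If the pair $(G,\{a,b\})$ is bad, then $\operatorname{mmw}(H)\ge 3$.
   Context: All graphs are finite and simple. A tree is subcubic if all its vertices have degree $1$ or $3$; a tree is nontrivial if it has at least one edge. A tree-representation of a graph $G$ is a pair $(T,\{T_x\}_{x\in V(G)})$ where $T$ is a subcubic tree and each $T_x$ is a nontrivial subtree of $T$, such that $T_u$ and $T_v$ share at least one vertex whenever $uv\in E(G)$; its width is the maximum, over edges $e$ of $T$, of the number of subtrees $T_x$ containing $e$. It is known that $\operatorname{mmw}(G)\le k$ iff $G$ has a tree-representation of width at most $k$, where $\operatorname{mmw}(G)$ is the maximum matching width: the minimum over branch-decompositions $(T,\mathcal{L})$ of $V(G)$ (subcubic tree $T$, bijection $\mathcal{L}$ from leaves to $V(G)$) of the maximum over edges of $T$ of the size of a maximum matching of $G$ between the two sides of the induced vertex partition. For distinct $a,b\in V(G)$, the pair $(G,\{a,b\})$ is good if $G$ has a tree-representation of width $2$ in which $T_a$ and $T_b$ share an edge of $T$, and bad otherwise. *)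

(* Defs.v *)
From mathcomp Require Import all_boot.
From mathcomp Require Import boolp.

Set Implicit Arguments.
Unset Strict Implicit.
Unset Printing Implicit Defensive.

Record sgraph := SGraph {
  vertex :> finType;
  adj : rel vertex;
  adj_sym : symmetric adj;
  adj_irrefl : irreflexive adj
}.

Declare Scope sgraph_scope.
Open Scope sgraph_scope.
Notation "x -- y" := (adj x y) (at level 30) : sgraph_scope.

Section Trees.
Variable T : sgraph.
Implicit Types (S : {set T}) (s t : T).

Definition deg t : nat := #|[set u : T | t -- u]|.

Definition leaf t : bool := deg t == 1.

Definition connected_on S : Prop :=
  S != set0 /\
  {in S &, forall s t, connect [rel u v | [&& u \in S, v \in S & u -- v]] s t}.

(* [ucycle] allows the degenerate cycle [:: u; v] that runs an edge back and
   forth, so genuine cycles are those of length at least 3. *)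
Definition acyclic : Prop := forall c : seq T, ucycle (@adj T) c -> size c < 3.

Definition is_tree : Prop := connected_on [set: T] /\ acyclic.

Definition subcubic_tree : Prop :=
  is_tree /\ forall t, (deg t == 1) || (deg t == 3).

(* A subtree of a tree T is an induced subgraph of T, hence is given by its
   vertex set, and it contains the edge uv of T iff it contains u and v. *)
Definition nontrivial_subtree S : Prop :=
  connected_on S /\ exists s t, [/\ s \in S, t \in S & s -- t].

Definition del_edge s t : rel T :=
  [rel u v | (u -- v) && ([set u; v] != [set s; t])].

End Trees.

Section TreeRepresentation.
Variables (G T : sgraph) (R : G -> {set T}).

Definition tree_representation : Prop :=
  [/\ subcubic_tree T,
      forall x, nontrivial_subtree (R x) &
      forall u v : G, u -- v -> R u :&: R v != set0].

Definition tr_width : nat :=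
  \max_(e : T * T | e.1 -- e.2) #|[set x : G | [set e.1; e.2] \subset R x]|.

End TreeRepresentation.

Definition good (G : sgraph) (a b : G) : Prop :=
  exists (T : sgraph) (R : G -> {set T}),
    [/\ tree_representation R,
        tr_width R = 2 &
        exists s t : T, [/\ s -- t, [set s; t] \subset R a
                                  & [set s; t] \subset R b]].

Definition bad (G : sgraph) (a b : G) : Prop := ~ good a b.

Section MaximumMatchingWidth.
Variable G : sgraph.

Definition cut_edges (A : {set G}) : {set {set G}} :=
  [set [set x; y] | x in A, y in ~: A & x -- y].

Definition max_cut_matching (A : {set G}) : nat :=
  \max_(M : {set {set G}} | (M \subset cut_edges A) && trivIset M) #|M|.

Section BranchDecomposition.
Variables (T : sgraph) (L : {t : T | leaf t} -> G).

Definition branch_decomposition : Prop := subcubic_tree T /\ bijective L.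

(* The vertices of G at the leaves of the component of T - st containing s. *)
Definition bd_side (s t : T) : {set G} :=
  [set L l | l : {t : T | leaf t} & connect (del_edge s t) s (val l)].

Definition bd_width : nat :=
  \max_(e : T * T | e.1 -- e.2) max_cut_matching (bd_side e.1 e.2).

End BranchDecomposition.

Definition has_bd_width (k : nat) : Prop :=
  exists (T : sgraph) (L : {t : T | leaf t} -> G),
    branch_decomposition L /\ bd_width L = k.

(* Graphs with at most one vertex have no branch-decomposition, since a
   subcubic tree has at least two leaves; they get the usual value 0. *)
Definition mmw : nat :=
  match pselect (exists k, `[< has_bd_width k >]) with
  | left ex => ex_minn ex
  | right _ => 0
  end.

End MaximumMatchingWidth.

Section Extension.
Variables (G : sgraph) (a b : G).

(* The new vertices c and d are [inr true] and [inr false]. *)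
Definition ext_adj : rel (G + bool) := fun u v =>
  match u, v with
  | inl x, inl y => del_edge a b x y
  | inl x, inr _ => x \in [set a; b]
  | inr _, inl y => y \in [set a; b]
  | inr _, inr _ => false
  end.

Lemma ext_adj_sym : symmetric ext_adj.
Proof. by move=> [x|i] [y|j] //; rewrite /= /del_edge /= adj_sym [[set x; y]]setUC. Qed.

Lemma ext_adj_irrefl : irreflexive ext_adj.
Proof. by move=> [x|i] //; rewrite /= /del_edge /= adj_irrefl. Qed.

Definition ext_graph : sgraph := SGraph ext_adj_sym ext_adj_irrefl.

End Extension.

(* Main.v *)
Require Import Defs.
From mathcomp Require Import all_boot zify.
From mathcomp Require Import boolp.

Set Implicit Arguments.
Unset Strict Implicit.
Unset Printing Implicit Defensive.

(**
A branch-decomposition of width at most 2 of the extension H yields a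
tree-representation of H of width at most 2: root the tree at an inner vertex
and, for the cut A of leaves below each tree edge, take the minimum vertex cover
(König) whose part inside A is as large as possible. By submodularity the sets
of tree edges whose cover contains a given vertex are connected.

In such a representation, the subtrees of a, c, b, d meet cyclically. If those
of c and d share an edge, then their intersection W meets the subtrees of a and
b (Helly) and its edges carry nothing but c and d, so W can be added to both.
If those of a and b share an edge there is nothing to do. Otherwise all four
have a common vertex v, and as v has degree at most 3, some edge at v lies in
one subtree of a, b and in one of c, d; it can be added to the other one of a, b.
*)

(** * Rooted trees *)

Lemma del_edge_sym (T : sgraph) (s t : T) : symmetric (del_edge s t).
Proof. by move=> u v; rewrite /del_edge /= adj_sym setUC. Qed.

(** A simple path from [u] to [v] avoiding the edge closes up with it to a cycle of length at least
    3. *)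
Lemma acyclic_bridge (T : sgraph) (u v : T) :
  acyclic T -> u -- v -> ~~ connect (del_edge u v) u v.
Proof.
move=> acT uv; apply/negP => /connectP[q pq lq].
case/shortenP: pq lq => q' pq' uq' _ lq.
have puq : path (@adj T) u q' by apply: sub_path pq' => x y /andP[].
have /acT : ucycle (@adj T) (u :: q').
  by rewrite /ucycle uq' andbT /= rcons_path puq -lq adj_sym.
case: q' pq' lq {uq' puq} => [_ lq|x [|//]].
  by rewrite lq adj_irrefl in uv.
by rewrite /= => /andP[/andP[_ /eqP h] _] vx; case: h; rewrite vx.
Qed.

(** [parent] is total, with an arbitrary value at depth 0; hence the guards. *)
Record rooting (T : sgraph) := Rooting {
  root : T;
  parent : T -> T;
  depth : T -> nat;
  depth_parent : forall u, 0 < depth u -> depth u = (depth (parent u)).+1;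
  adj_parent : forall u, 0 < depth u -> u -- parent u;
  adj_rooting : forall u v, u -- v ->
    (0 < depth u /\ parent u = v) \/ (0 < depth v /\ parent v = u);
  depth0_root : forall u, depth u = 0 -> u = root
}.

(** [depth] is the length of a shortest walk from [r], and [parent] the last but one vertex of such
    a walk. *)
Lemma tree_rooting (T : sgraph) (r : T) :
  is_tree T -> exists q : rooting T, root q = r.
Proof.
move=> [[_ conT] acT].
pose walk u n := [exists t : n.-tuple T, path (@adj T) r t && (last r t == u)].
have exw u : exists n, walk u n.
  have /connectP[q pq ->] := conT r u (in_setT _) (in_setT _).
  exists (size q); apply/existsP; exists (in_tuple q); rewrite eqxx andbT /=.
  by apply: sub_path pq => x y /and3P[].
pose d u := ex_minn (exw u).
have dw u : walk u (d u) by rewrite /d; case: ex_minnP.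
have dmin u n : walk u n -> d u <= n by rewrite /d; case: ex_minnP => m _; apply.
have par u : exists v, 0 < d u -> u -- v /\ d u = (d v).+1.
  have /existsP[[q /= sq] /andP[pq /eqP lq]] := dw u.
  case/lastP: q sq pq lq => [|q v] sq; first by exists u; rewrite -(eqP sq).
  rewrite rcons_path last_rcons => /andP[pq adjv] vu; exists (last r q) => _.
  rewrite adj_sym -vu; split=> //; rewrite vu.
  have dq : d (last r q) <= size q.
    by apply: dmin; apply/existsP; exists (in_tuple q); rewrite /= pq eqxx.
  have : d u <= (d (last r q)).+1.
    have /existsP[[q' /= sq'] /andP[pq' /eqP lq']] := dw (last r q).
    apply: dmin; apply/existsP.
    have sz : size (rcons q' u) == (d (last r q)).+1 by rewrite size_rcons eqSS.
    exists (Tuple sz); rewrite /= rcons_path pq' lq' last_rcons eqxx andbT -vu.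
    exact: adjv.
  by move: sq; rewrite size_rcons => /eqP; lia.
have [p pP] := choice par.
have d0 u : d u = 0 -> u = r.
  move=> du; have /existsP[[q /= sq] /andP[_ /eqP <-]] := dw u.
  by rewrite du in sq; case: q sq.
suff adjp u v : u -- v -> (0 < d u /\ p u = v) \/ (0 < d v /\ p v = u).
  by exists (@Rooting T r p d (fun u du => (pP u du).2) (fun u du => (pP u du).1)
     adjp d0).
move=> uv; apply: contrapT => nor.
(* Otherwise the edge uv is not of the form {w, p w}, so that the ascending
   paths from u and v to the root bypass it. *)
have up w : connect (del_edge u v) w r.
  move: {2}(d w) (erefl (d w)) => n; elim: n w => [|n IH] w dn.
    by rewrite (d0 _ dn).
  have [adw dpw] := pP w ltac:(lia).
  apply: connect_trans (IH (p w) _); last lia.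
  apply: connect1; rewrite /del_edge /= adw; apply/eqP => h; apply: nor.
  have := set21 w (p w); have := set22 w (p w).
  rewrite h !inE; move: (@adj_irrefl T w).
  move=> irr /orP[]/eqP e1 /orP[]/eqP e2; rewrite ?e1 ?e2 in adw irr *.
  - by rewrite irr in adw.
  - by right; split; [rewrite -e2; lia|rewrite -{1}e2].
  - by left; split; [rewrite -e2; lia|rewrite -{1}e2].
  - by rewrite irr in adw.
have := acyclic_bridge acT uv; apply/negP; rewrite negbK.
apply: connect_trans (up u) _.
by rewrite (sym_connect_sym (@del_edge_sym T u v)).
Qed.

Section Rooted.
Variables (T : sgraph) (q : rooting T).
Local Notation p := (parent q).
Local Notation d := (depth q).
Implicit Types (u v w : T) (S : {set T}).

(** The comparison of depths guards the truncated subtraction. Every vertex counts as its own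
    ancestor. *)
Definition anc w u := (d w <= d u) && (iter (d u - d w) p u == w).

Lemma depth_iter n u : n <= d u -> d (iter n p u) = d u - n.
Proof.
elim: n => [|n IH] h; first by rewrite subn0.
rewrite iterS; have := depth_parent (_ : 0 < d (iter n p u)).
by rewrite IH ?subn_gt0 ?(ltnW h) // => /(_ h); lia.
Qed.

Lemma anc_refl w : anc w w.
Proof. by rewrite /anc leqnn subnn /=. Qed.

Lemma anc_depth w u : anc w u -> d w <= d u.
Proof. by case/andP. Qed.

Lemma anc_parent w u : 0 < d w -> anc w u -> anc (p w) u.
Proof.
move=> dw /andP[le /eqP e]; have dpw := depth_parent dw.
apply/andP; split; first lia.
have -> : d u - d (p w) = (d u - d w).+1 by lia.
by rewrite iterS e.
Qed.

Lemma anc_below w u : 0 < d u -> anc w (p u) -> anc w u.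
Proof.
move=> du /andP[le /eqP e]; have dpu := depth_parent du.
apply/andP; split; first lia.
have -> : d u - d w = (d (p u) - d w).+1 by lia.
by rewrite iterSr e.
Qed.

Lemma anc_proper w u : anc w u -> u != w -> d w < d u.
Proof.
move=> /andP[le /eqP e] uw; rewrite ltn_neqAle le andbT.
by apply: contra uw => /eqP h; rewrite -e h subnn.
Qed.

Lemma anc_above w u : anc w u -> u != w -> anc w (p u).
Proof.
move=> awu uw; have lt := anc_proper awu uw; case/andP: awu => le /eqP e.
have dpu := depth_parent (leq_ltn_trans (leq0n _) lt).
apply/andP; split; first lia.
have ee : d u - d w = (d (p u) - d w).+1 by lia.
by rewrite -iterSr -ee e.
Qed.

Lemma anc_inj w w' u : anc w u -> anc w' u -> d w = d w' -> w = w'.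
Proof. by move=> /andP[_ /eqP e] /andP[_ /eqP e'] h; rewrite -e -e' h. Qed.

Lemma anc_child w u : anc w u -> u != w ->
  exists w', [/\ 0 < d w', p w' = w & anc w' u].
Proof.
move=> awu uw; have lt := anc_proper awu uw; case/andP: awu => le /eqP e.
have ee : d u - d w = (d u - d w).-1.+1 by lia.
have dw' : d (iter (d u - d w).-1 p u) = (d w).+1 by rewrite depth_iter; lia.
exists (iter (d u - d w).-1 p u); split; first by rewrite dw'.
  by rewrite -iterS -ee.
apply/andP; rewrite dw'; split=> //; apply/eqP; congr iter; lia.
Qed.

Lemma anc_root w u : d w = 0 -> anc w u.
Proof.
move=> dw; rewrite /anc dw subn0 (depth0_root dw).
by apply/eqP/depth0_root; rewrite depth_iter // subnn.
Qed.

Lemma anc_leaf w u : leaf w -> 0 < d w -> anc w u -> u = w.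
Proof.
move=> /cards1P[z ez] dw awu; apply/eqP/negPn/negP => uw.
have [w' [dw' pw' _]] := anc_child awu uw.
have : p w \in [set x | w -- x] by rewrite inE adj_parent.
have : w' \in [set x | w -- x] by rewrite inE adj_sym -pw' adj_parent.
rewrite ez !inE => /eqP e' /eqP e.
by have := depth_parent dw; have := depth_parent dw'; rewrite pw' e e'; lia.
Qed.

(** The descendants of [w] are closed under all edges but the one to its parent, and each climbs to
    [w] without using that edge. This reads the sides of cuts off the rooting. *)
Lemma connect_del_parent w u : 0 < d w ->
  connect (del_edge w (p w)) w u = anc w u.
Proof.
move=> dw; have csym := sym_connect_sym (@del_edge_sym T w (p w)).
apply/idP/idP => [cwu|].
  have cl : closed (del_edge w (p w)) [pred x | anc w x].
    apply: (intro_closed csym) => x y /andP[xy /eqP ne].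
    rewrite !inE => awx; have [[dx e]|[dy e]] := adj_rooting q xy.
      rewrite -e; apply: anc_above => //; apply/eqP => xw.
      by apply: ne; rewrite -e xw.
    by apply: anc_below; rewrite ?e.
  by have := closed_connect cl cwu; rewrite !inE anc_refl.
rewrite csym; move: {2}(d u) (leqnn (d u)) => n.
elim: n u => [|n IH] u le awu.
  by have := anc_depth awu; lia.
have [->|uw] := eqVneq u w; first exact: connect0.
have lt := anc_proper awu uw; have du : 0 < d u by lia.
have dpu := depth_parent du; have dpw := depth_parent dw.
apply: connect_trans (IH (p u) _ (anc_above awu uw)); last lia.
apply: connect1; rewrite /del_edge /= adj_parent //=.
apply/eqP => /setP/(_ u); rewrite !inE eqxx (negPf uw) /= => /esym/eqP e.
by rewrite e in lt; lia.
Qed.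

End Rooted.

(** * Subtrees *)

Section Subtrees.
Variable T : sgraph.
Implicit Types (u v w : T) (S : {set T}).

Definition induced S : rel T := [rel u v | [&& u \in S, v \in S & u -- v]].

Lemma induced_sym S : symmetric (induced S).
Proof. by move=> u v; rewrite /induced /= adj_sym andbCA. Qed.

Lemma connect_del_edge S u v x y : connected_on S -> x \in S -> y \in S ->
  ~~ ((u \in S) && (v \in S)) -> connect (del_edge u v) x y.
Proof.
move=> [_ cS] xS yS nuv; apply: connect_sub (cS x y xS yS) => s t /and3P[sS tS st].
apply: connect1; rewrite /del_edge /= st; apply/eqP => h.
have : (u \in [set s; t]) && (v \in [set s; t]) by rewrite h !inE !eqxx orbT.
move=> /andP[us vs]; case/negP: nuv.
by move: us vs; rewrite !inE => /orP[]/eqP-> /orP[]/eqP->; rewrite ?sS ?tS.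
Qed.

Lemma connected_onI S S' : is_tree T -> connected_on S -> connected_on S' ->
  S :&: S' != set0 -> connected_on (S :&: S').
Proof.
move=> [_ acT] cS cS' ne; split=> // s t; rewrite !inE => /andP[sS sS'] /andP[tS tS'].
have /connectP[l pl lt] := cS.2 s t sS tS.
case/shortenP: pl lt => {}l pl ul _ lt.
elim: l s sS sS' pl ul lt => [|x l IH] s sS sS' /=.
  by move=> _ _ ->.
move=> /andP[/and3P[_ xS sx] pl] /and3P[snx xl ul] lt.
(* Otherwise the bridge [s -- x] is bypassed: from [s] to [t] inside [S'], then back to [x] along
   the rest of the path, which avoids [s]. *)
have xS' : x \in S'.
  apply: contraT => nx; have := acyclic_bridge acT sx.
  rewrite (@connect_trans _ _ t) //.
    by apply: (connect_del_edge cS') => //; rewrite (negPf nx) andbF.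
  rewrite (sym_connect_sym (@del_edge_sym T s x)); apply/connectP; exists l => //.
  apply: (@sub_in_path _ (predC1 s) _ _ _ x l _ pl).
    move=> y z; rewrite !inE => ys zs /and3P[_ _ yz]; rewrite /del_edge /= yz /=.
    by apply/eqP => /setP/(_ s); rewrite !inE eqxx ![s == _]eq_sym (negPf ys) (negPf zs).
  by apply/allP => y yl; apply: contraNneq snx => <-.
apply: connect_trans (IH x xS xS' pl _ lt); last by rewrite /= xl.
by apply: connect1; rewrite /= !inE sS sS' xS xS'.
Qed.

(** A path in [S] from [s] to a vertex not below [s] must leave through the edge to the parent of
    [s]. *)
Lemma subtree_parent (q : rooting T) S s s' : connected_on S -> s \in S -> s' \in S ->
  ~~ anc q s s' -> parent q s \in S.
Proof.
move=> cS sS s'S; apply: contraR => ps.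
have [/(anc_root s')//|ds] := posnP (depth q s).
rewrite -(connect_del_parent _ ds).
by apply: (connect_del_edge cS) => //; rewrite (negPf ps) andbF.
Qed.

(** A vertex strictly below [w] is deeper than [t], hence no ancestor of [t], so the climb from [z]
    to [w] stays in [S]. *)
Lemma subtree_ascend (q : rooting T) S t z w : connected_on S -> t \in S -> z \in S ->
  anc q w z -> depth q t <= depth q w -> w \in S.
Proof.
move=> cS tS zS awz tw; move: {2}(depth q z) (leqnn (depth q z)) => n.
elim: n z zS awz => [|n IH] z zS awz le; have [<-//|zw] := eqVneq z w;
  have lt := anc_proper awz zw; first lia.
apply: (IH (parent q z)) (anc_above awz zw) _.
  by apply: (subtree_parent cS zS tS); apply/negP => /anc_depth; lia.
have /depth_parent : 0 < depth q z by lia.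
lia.
Qed.

Lemma subtree_top (q : rooting T) S : connected_on S ->
  exists2 t, t \in S & {in S, forall z, depth q t <= depth q z /\ anc q t z}.
Proof.
move=> cS; have /set0Pn[s sS] := cS.1.
case: (@arg_minnP _ s (mem S) (depth q) sS) => t tS tmin.
exists t => // z zS; split; first exact: tmin.
apply: contraT => naz; have := tmin _ (subtree_parent cS tS zS naz).
have [/(anc_root z)|/depth_parent] := posnP (depth q t); last lia.
by rewrite (negPf naz).
Qed.

(** From a common vertex, [S'] climbs to the top [t] of [S]. So the deepest of several tops lies in
    every subtree that meets its own, which yields the Helly property. *)
Lemma subtree_top_mem (q : rooting T) S S' t t' : connected_on S' -> t' \in S' ->
  {in S, forall z, depth q t <= depth q z /\ anc q t z} ->
  depth q t' <= depth q t -> S :&: S' != set0 -> t \in S'.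
Proof.
move=> cS' t'S' tP le /set0Pn[z /setIP[zS zS']].
exact: (subtree_ascend cS' t'S' zS' (tP z zS).2).
Qed.

Lemma subtree_helly S1 S2 S3 : is_tree T ->
  connected_on S1 -> connected_on S2 -> connected_on S3 ->
  S1 :&: S2 != set0 -> S1 :&: S3 != set0 -> S2 :&: S3 != set0 ->
  exists v, [/\ v \in S1, v \in S2 & v \in S3].
Proof.
move=> tT c1 c2 c3 i12 i13 i23; have /set0Pn[r _] := c1.1.
have [q _] := tree_rooting r tT.
have [t1 m1 p1] := subtree_top q c1; have [t2 m2 p2] := subtree_top q c2.
have [t3 m3 p3] := subtree_top q c3.
have [le12|/ltnW le21] := leqP (depth q t1) (depth q t2).
  have [le23|/ltnW le32] := leqP (depth q t2) (depth q t3).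
    exists t3; split=> //; [apply: (subtree_top_mem c1 m1 p3)|
      apply: (subtree_top_mem c2 m2 p3)]; rewrite // ?[S3 :&: _]setIC //; lia.
  exists t2; split=> //; [apply: (subtree_top_mem c1 m1 p2)|
    apply: (subtree_top_mem c3 m3 p2)]; rewrite // ?[S2 :&: S1]setIC //; lia.
have [le13|/ltnW le31] := leqP (depth q t1) (depth q t3).
  exists t3; split=> //; [apply: (subtree_top_mem c1 m1 p3)|
    apply: (subtree_top_mem c2 m2 p3)]; rewrite // ?[S3 :&: _]setIC //; lia.
exists t1; split=> //; [apply: (subtree_top_mem c2 m2 p1)|
  apply: (subtree_top_mem c3 m3 p1)]; rewrite //; lia.
Qed.

(* The deepest of the four tops lies in both neighbours, on the 4-cycle, of its
   subtree. *)
Lemma subtree_chord (A B C D : {set T}) : is_tree T ->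
  connected_on A -> connected_on B -> connected_on C -> connected_on D ->
  A :&: C != set0 -> A :&: D != set0 -> B :&: C != set0 -> B :&: D != set0 ->
  A :&: B != set0 \/ C :&: D != set0.
Proof.
move=> tT cA cB cC cD iAC iAD iBC iBD; have /set0Pn[r _] := cA.1.
have [q _] := tree_rooting r tT.
have [a mA pA] := subtree_top q cA; have [b mB pB] := subtree_top q cB.
have [c mC pC] := subtree_top q cC; have [d mD pD] := subtree_top q cD.
have [iCA iCB] : C :&: A != set0 /\ C :&: B != set0 by rewrite ![C :&: _]setIC.
have [iDA iDB] : D :&: A != set0 /\ D :&: B != set0 by rewrite ![D :&: _]setIC.
have: [|| (depth q c <= depth q a) && (depth q d <= depth q a),
          (depth q c <= depth q b) && (depth q d <= depth q b),
          (depth q a <= depth q c) && (depth q b <= depth q c) |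
          (depth q a <= depth q d) && (depth q b <= depth q d)].
  by clear; lia.
case/or4P => /andP[le1 le2].
- right; apply/set0Pn; exists a; rewrite inE.
  by rewrite (subtree_top_mem cC mC pA) ?(subtree_top_mem cD mD pA).
- right; apply/set0Pn; exists b; rewrite inE.
  by rewrite (subtree_top_mem cC mC pB) ?(subtree_top_mem cD mD pB).
- left; apply/set0Pn; exists c; rewrite inE.
  by rewrite (subtree_top_mem cA mA pC) ?(subtree_top_mem cB mB pC).
- left; apply/set0Pn; exists d; rewrite inE.
  by rewrite (subtree_top_mem cA mA pD) ?(subtree_top_mem cB mB pD).
Qed.

Lemma connected_nbr S v w : connected_on S -> v \in S -> w \in S -> v != w ->
  exists2 u, u \in S & v -- u.
Proof.
move=> [_ cS] vS wS vw; have /connectP[[|u l] /= pl lw] := cS v w vS wS.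
  by rewrite lw eqxx in vw.
by case/andP: pl => /and3P[_ uS vu] _; exists u.
Qed.

Lemma connected_onU S S' : connected_on S -> connected_on S' ->
  S :&: S' != set0 -> connected_on (S :|: S').
Proof.
move=> cS cS' /set0Pn[v /setIP[vS vS']]; split.
  by apply/set0Pn; exists v; rewrite inE vS.
have sub S1 S2 : subrel (connect (induced S1)) (connect (induced (S1 :|: S2))).
  apply: connect_sub => x y /and3P[xS yS xy]; apply: connect1.
  by rewrite /induced /= !inE xS yS.
have toV s : s \in S :|: S' -> connect (induced (S :|: S')) s v.
  rewrite inE => /orP[] sS; first by apply: sub; apply: cS.2.
  by rewrite setUC; apply: sub; apply: cS'.2.
move=> s t sU tU; apply: connect_trans (toV s sU) _.
by have := toV t tU; rewrite (sym_connect_sym (@induced_sym _)).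
Qed.

(** An edge from a vertex of [S] only to a vertex of [S'] only would be a bridge bypassed through a
    common vertex [z]. *)
Lemma edge_setU S S' u v : is_tree T -> connected_on S -> connected_on S' ->
  S :&: S' != set0 -> u -- v -> [set u; v] \subset S :|: S' ->
  ([set u; v] \subset S) || ([set u; v] \subset S').
Proof.
move=> [_ acT] cS cS' /set0Pn[z /setIP[zS zS']].
have key x y : x -- y -> x \in S -> y \in S' -> (y \in S) || (x \in S').
  move=> xy xS yS'; apply: contraT => /norP[nyS nxS'].
  have := acyclic_bridge acT xy; rewrite (@connect_trans _ _ z) //.
    by apply: (connect_del_edge cS); rewrite ?(negPf nyS) ?andbF.
  by apply: (connect_del_edge cS'); rewrite ?(negPf nxS').
move=> uv; rewrite !subUset !sub1set !inE => /andP[/orP[]us /orP[]vs];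
  rewrite us vs ?orbT ?andbT //=.
  exact: key.
by apply: key; rewrite // adj_sym.
Qed.

Lemma connected_edge u v : u -- v -> connected_on [set u; v].
Proof.
move=> uv; split; first by apply/set0Pn; exists u; rewrite !inE eqxx.
have c : connect (induced [set u; v]) u v.
  by apply: connect1; rewrite /induced /= !inE !eqxx orbT.
move=> s t; rewrite !inE => /orP[]/eqP-> /orP[]/eqP-> //.
by rewrite (sym_connect_sym (@induced_sym _)).
Qed.

End Subtrees.

(** * König's theorem and canonical vertex covers of cuts *)

(** König duality for the bipartite graph [E]: [M] is a matching, its edges having distinct ends on
    both sides, and [P], [Q] form a vertex cover no larger than it. *)
Definition konig_dual (X Y : finType) (E : {set X * Y}) : Prop :=
  exists (M : {set X * Y}) (P : {set X}) (Q : {set Y}),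
  [/\ M \subset E, {in M &, injective fst}, {in M &, injective snd},
      {in E, forall e, (e.1 \in P) || (e.2 \in Q)} & #|P| + #|Q| <= #|M|].

Lemma konig_dual_swap (X Y : finType) (E : {set X * Y}) :
  konig_dual [set (e.2, e.1) | e in E] -> konig_dual E.
Proof.
move=> [M [Q [P [sME i1 i2 cE cM]]]].
have sw_inj : injective (fun e : Y * X => (e.2, e.1)) by move=> [? ?] [? ?] [-> ->].
exists [set (e.2, e.1) | e in M], P, Q; split.
- by apply/subsetP=> _ /imsetP[e /(subsetP sME)/imsetP[f fE ->] ->]; case: f fE.
- by move=> _ _ /imsetP[e eM ->] /imsetP[f fM ->] /= /(i2 e f eM fM) ->.
- by move=> _ _ /imsetP[e eM ->] /imsetP[f fM ->] /= /(i1 e f eM fM) ->.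
- by move=> e eE; rewrite orbC (cE (e.2, e.1)) //; apply: imset_f.
- by rewrite card_imset // addnC.
Qed.

(* Uncrossing: if neither of the two smaller covers covers E, they combine into
   two covers of E of total size one more, and one of these is small enough. *)
Lemma konig_dual_fork (X Y : finType) (E : {set X * Y}) (x : X) (y z : Y) :
  (x, y) \in E -> (x, z) \in E -> y != z ->
  konig_dual (E :\ (x, y)) -> konig_dual (E :\ (x, z)) -> konig_dual E.
Proof.
move=> xy xz yz [M1 [P1 [Q1 [s1 i1 j1 c1 m1]]]] [M2 [P2 [Q2 [s2 i2 j2 c2 m2]]]].
have t1 : M1 \subset E := subset_trans s1 (subD1set _ _).
have t2 : M2 \subset E := subset_trans s2 (subD1set _ _).
have := c1 (x, z); rewrite !inE xz andbT xpair_eqE eqxx eq_sym yz => /(_ isT) /= cz.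
have := c2 (x, y); rewrite !inE xy andbT xpair_eqE eqxx yz => /(_ isT) /= cy.
have [h1|/norP[xP1 yQ1]] := boolP ((x \in P1) || (y \in Q1)).
  exists M1, P1, Q1; split=> // e eE; have [->//|ne] := eqVneq e (x, y).
  by apply: c1; rewrite !inE ne.
have [h2|/norP[xP2 zQ2]] := boolP ((x \in P2) || (z \in Q2)).
  exists M2, P2, Q2; split=> // e eE; have [->//|ne] := eqVneq e (x, z).
  by apply: c2; rewrite !inE ne.
(* As [x] is in neither cover, [z] lies in [Q1] and [y] in [Q2]. *)
rewrite (negPf xP1) /= in cz; rewrite (negPf xP2) /= in cy.
have cov1 : {in E, forall e, (e.1 \in P1 :&: P2) || (e.2 \in Q1 :|: Q2)}.
  move=> e eE; rewrite !inE.
  have [->|n1] := eqVneq e (x, y); first by rewrite cy !orbT.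
  have [->|n2] := eqVneq e (x, z); first by rewrite cz !orbT.
  have := c1 e; have := c2 e; rewrite !inE n1 n2 eE => /(_ isT) + /(_ isT).
  by do 4!case: (_ \in _).
have cov2 : {in E, forall e, (e.1 \in x |: (P1 :|: P2)) || (e.2 \in Q1 :&: Q2)}.
  move=> e eE; rewrite !inE.
  have [->|n1] := eqVneq e (x, y); first by rewrite /= eqxx.
  have [->|n2] := eqVneq e (x, z); first by rewrite /= eqxx.
  have := c1 e; have := c2 e; rewrite !inE n1 n2 eE => /(_ isT) + /(_ isT).
  by do 4!case: (_ \in _); rewrite ?orbT.
have kP := cardsUI P1 P2; have kQ := cardsUI Q1 Q2.
have kx : #|x |: (P1 :|: P2)| <= #|P1 :|: P2|.+1.
  by rewrite cardsU1 -add1n leq_add2r leq_b1.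
have [le1|gt1] := leqP (#|P1 :&: P2| + #|Q1 :|: Q2|) #|M1|.
  by exists M1, (P1 :&: P2), (Q1 :|: Q2).
by exists M2, (x |: (P1 :|: P2)), (Q1 :&: Q2); split=> //; clear -kP kQ kx gt1 m1 m2; lia.
Qed.

(** Induction on the number of edges: two edges with a common end form a fork; without such a pair
    [E] is itself a matching, covered by its ends in [X]. *)
Lemma konig (X Y : finType) (E : {set X * Y}) : konig_dual E.
Proof.
move: {2}#|E| (leqnn #|E|) => n; elim: n X Y E => [|n IH] X Y E leE.
  exists set0, set0, set0; rewrite sub0set !cards0; split=> // [e f|e f|e];
    rewrite ?inE //.
  by move: leE; rewrite leqn0 cards_eq0 => /eqP->; rewrite inE.
have fork (X' Y' : finType) (F : {set X' * Y'}) : #|F| = #|E| ->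
    ~ {in F &, injective fst} -> konig_dual F.
  move=> cF /existsNP[[x y]] /existsNP[[x' z]] /not_implyP[xy] /not_implyP[xz].
  move=> /not_implyP[/= xx' ne]; rewrite -{x'}xx' in xz ne.
  have yz : y != z by apply/eqP => yz; apply: ne; rewrite yz.
  apply: (konig_dual_fork xy xz yz); apply: IH; move: leE.
    by rewrite -cF (cardsD1 (x, y)) xy.
  by rewrite -cF (cardsD1 (x, z)) xz.
have [i1|] := pselect ({in E &, injective fst}); last exact: fork.
have [i2|n2] := pselect ({in E &, injective snd}).
  exists E, [set e.1 | e in E], set0; rewrite cards0 addn0 leq_imset_card.
  by split=> // e eE; rewrite imset_f.
apply: konig_dual_swap; apply: fork.
  by rewrite card_imset // => -[? ?] [? ?] [-> ->].
apply: contra_not n2 => i1' e f eE fE ef.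
have := i1' (e.2, e.1) (f.2, f.1) (imset_f _ eE) (imset_f _ fE) ef.
by case: e f {eE fE ef} => [? ?] [? ?] [-> ->].
Qed.

Lemma card_sum_mem (T : finType) (A : {set T}) : #|A| = \sum_x (x \in A).
Proof. by rewrite -sum1_card big_mkcond /=; apply: eq_bigr => x _; case: (x \in A). Qed.

(** * Extremal minimum vertex covers of cuts and their uncrossing *)

Section Covers.
Variable G : sgraph.
Implicit Types (A B S : {set G}) (x y : G).

Definition nbhd S : {set G} := [set y | [exists x in S, x -- y]].

Lemma nbhdP S y : reflect (exists2 x, x \in S & x -- y) (y \in nbhd S).
Proof. by rewrite inE; apply: exists_inP. Qed.

Lemma nbhdS S S' : S \subset S' -> nbhd S \subset nbhd S'.
Proof.
move=> sS; apply/subsetP => y /nbhdP[x xS xy]; apply/nbhdP; exists x => //.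
exact: (subsetP sS).
Qed.

Lemma nbhdU S S' : nbhd (S :|: S') = nbhd S :|: nbhd S'.
Proof.
apply/eqP; rewrite eqEsubset subUset !nbhdS ?subsetUl ?subsetUr // !andbT.
apply/subsetP => y /nbhdP[x]; rewrite in_setU => /orP[] xS xy; apply/setUP.
  by left; apply/nbhdP; exists x.
by right; apply/nbhdP; exists x.
Qed.

(* If S is the uncovered part of A, then A :\: S together with the neighbours of
   S outside A is the smallest vertex cover of the cut (A, ~: A). *)
Definition cut_cover A S : {set G} := (A :\: S) :|: (nbhd S :\: A).

Lemma cut_coverP A S x :
  (x \in cut_cover A S) = if x \in A then x \notin S else x \in nbhd S.
Proof.
rewrite !in_setU !in_setD; case: (x \in A) => /=; first by rewrite andbT orbF.
by rewrite andbF.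
Qed.

(** König's theorem gives a cover [P], [Q] of the cut as small as some matching. For [S = A :\: P],
    the part of [cut_cover A S] inside [A] lies in [P] and the rest in [Q]. *)
Lemma cut_cover_exists A : exists2 S : {set G}, S \subset A &
  #|cut_cover A S| <= max_cut_matching A.
Proof.
pose E := [set e : G * G | [&& e.1 \in A, e.2 \notin A & e.1 -- e.2]].
have [M [P [Q [sME i1 i2 cE cM]]]] := konig E.
exists (A :\: P); first exact: subsetDl.
have ME e : e \in M -> [/\ e.1 \in A, e.2 \notin A & e.1 -- e.2].
  by move/(subsetP sME); rewrite inE => /and3P[].
apply: leq_trans (leq_trans cM _).
  apply: leq_trans (leq_card_setU _ _) _; apply: leq_add; apply: subset_leq_card.
    by apply/subsetP => x; rewrite !inE; case: (x \in A) (x \in P) => [] [].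
  apply/subsetP => y /setDP[/nbhdP[x]]; rewrite inE => /andP[xP xA] xy yA.
  by have := cE (x, y); rewrite /= (negPf xP) /= => -> //; rewrite inE /= xA yA.
have meet e f z : e \in M -> f \in M -> z \in [set e.1; e.2] -> z \in [set f.1; f.2] ->
    e = f.
  move=> eM fM; have [e1 e2 _] := ME e eM; have [f1 f2 _] := ME f fM.
  rewrite !inE => /orP[]/eqP-> /orP[]/eqP ef.
  - exact: i1.
  - by rewrite ef (negPf f2) in e1.
  - by rewrite ef f1 in e2.
  - exact: i2.
(* The ordered pairs of the matching become the unordered edges counted by [max_cut_matching]. *)
pose M' := [set [set e.1; e.2] | e in M].
have -> : #|M| = #|M'|.
  rewrite card_in_imset // => e f eM fM ef; apply: (@meet _ _ e.1) => //.
    exact: set21.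
  by rewrite -ef set21.
apply: (@leq_bigmax_cond _ _ (fun M : {set {set G}} => #|M|)); apply/andP; split.
  apply/subsetP => _ /imsetP[e eM ->]; have [e1 e2 e12] := ME e eM.
  by apply/imset2P; exists e.1 e.2; rewrite ?inE // e2.
apply/trivIsetP => _ _ /imsetP[e eM ->] /imsetP[f fM ->] ne.
apply/pred0P => z /=; apply/negP => /andP[ze zf].
by case/eqP: ne; rewrite (meet e f z).
Qed.

(** As [K] exceeds every cardinality, the weight is lexicographic: first the size of the cover is
    minimised, then that of the uncovered part [S]. *)
Lemma tight_exists A : exists S : {set G}, [/\ S \subset A,
  forall S' : {set G}, S' \subset A -> #|cut_cover A S| <= #|cut_cover A S'| &
  forall S' : {set G}, S' \proper S -> #|cut_cover A S| < #|cut_cover A S'|].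
Proof.
pose K := #|G|.+1.
have h0 : set0 \subset A := sub0set A.
case: (@arg_minnP _ set0 (fun S : {set G} => S \subset A)
  (fun S => #|cut_cover A S| * K + #|S|) h0) => S sSA Smin.
have ltK (X : {set G}) : #|X| < K by rewrite ltnS max_card.
have Sle (S' : {set G}) : S' \subset A -> #|cut_cover A S| <= #|cut_cover A S'|.
  by move=> /Smin; have := ltK S; have := ltK S'; nia.
exists S; split=> // S' pS; have sS' := subset_trans (proper_sub pS) sSA.
by have := Smin _ sS'; have := proper_card pS; have := Sle _ sS'; nia.
Qed.

Definition tight A : {set G} := projT1 (cid (tight_exists A)).

Lemma tight_sub A : tight A \subset A.
Proof. by rewrite /tight; case: cid => S /= []. Qed.

Lemma tight_min A S : S \subset A -> #|cut_cover A (tight A)| <= #|cut_cover A S|.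
Proof. by rewrite /tight; case: cid => S' /= [_ h _]; apply: h. Qed.

(** The form in which extremality is used: uncrossing yields a subset of [tight A] whose cover is no
    larger, and this must be all of [tight A]. *)
Lemma tight_minimal A S : S \subset tight A ->
  #|cut_cover A S| <= #|cut_cover A (tight A)| -> S = tight A.
Proof.
move=> sS; rewrite leqNgt; apply: contraNeq => ne; move: sS ne.
rewrite /tight; case: cid => S' /= [_ _ h] sS ne; apply: h.
by rewrite properEneq ne.
Qed.

Definition tight_cover A := cut_cover A (tight A).

Lemma tight_coverP A x :
  (x \in tight_cover A) = if x \in A then x \notin tight A else x \in nbhd (tight A).
Proof. exact: cut_coverP. Qed.

Lemma tight_cover_card A : #|tight_cover A| <= max_cut_matching A.
Proof. by have [S sS] := cut_cover_exists A; apply: leq_trans; apply: tight_min. Qed.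

(** The choice [S = set0] covers the cut by [A] itself. At a leaf this bounds the cover by one
    vertex. *)
Lemma tight_cover_leq_card A : #|tight_cover A| <= #|A|.
Proof.
apply: leq_trans (tight_min (sub0set A)) _; apply: subset_leq_card.
apply/subsetP => x; rewrite cut_coverP; case: ifP => // _.
by case/nbhdP=> y; rewrite inE.
Qed.

Lemma tight_cover_edge A x y : x \in A -> y \notin A -> x -- y ->
  (x \in tight_cover A) || (y \in tight_cover A).
Proof.
move=> xA yA xy; rewrite !tight_coverP xA (negPf yA).
have [xS|//] := boolP (x \in tight A).
by apply/nbhdP; exists x.
Qed.

(* Submodularity of S |-> #|cut_cover A S|, across nested cuts. *)
Lemma tight_mono A B : A \subset B -> tight A \subset tight B.
Proof.
move=> sAB; have sA := tight_sub A; have sB := tight_sub B.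
set S := tight A; set S' := tight B.
suff : S :&: S' = S by move/setIidPl.
have sI : S :&: S' \subset A := subset_trans (subsetIl _ _) sA.
have sU : S :|: S' \subset B by rewrite subUset sB (subset_trans sA).
apply: tight_minimal (subsetIl _ _) _; have := tight_min sU.
suff : #|cut_cover B (S :|: S')| + #|cut_cover A (S :&: S')| <=
       #|cut_cover B S'| + #|cut_cover A S| by rewrite -/S -/S'; lia.
(* The inequality holds vertex by vertex, by a finite check of memberships. *)
rewrite !card_sum_mem -!big_split /=; apply: leq_sum => x _.
rewrite !cut_coverP nbhdU !in_setU !in_setI.
have nI : (x \in nbhd (S :&: S')) ==> (x \in nbhd S) && (x \in nbhd S').
  by apply/implyP => h; rewrite !(subsetP (nbhdS _) _ h) ?subsetIl ?subsetIr.
move: nI (introT implyP (subsetP sAB x)).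
move: (introT implyP (subsetP sA x)) (introT implyP (subsetP sB x)).
rewrite -/S -/S'; case: (x \in A); case: (x \in B); case: (x \in S);
by case: (x \in S') => //; do 3!case: (x \in _).
Qed.

(* Posimodularity: removing from each set the neighbours of the other does not
   increase the total size of the two covers. *)
Lemma tight_disjoint A B x : [disjoint A & B] ->
  x \in tight A -> x \notin nbhd (tight B).
Proof.
move=> dAB; have sA := tight_sub A; have sB := tight_sub B.
set S := tight A; set S' := tight B => xS.
suff e : S :\: nbhd S' = S by move: xS; rewrite -e inE => /andP[].
have sA' : S :\: nbhd S' \subset A := subset_trans (subsetDl _ _) sA.
have sB' : S' :\: nbhd S \subset B := subset_trans (subsetDl _ _) sB.
apply: tight_minimal (subsetDl _ _) _; have := tight_min sB'.
suff : #|cut_cover A (S :\: nbhd S')| + #|cut_cover B (S' :\: nbhd S)| <=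
       #|cut_cover A S| + #|cut_cover B S'| by rewrite -/S -/S'; lia.
rewrite !card_sum_mem -!big_split /=; apply: leq_sum => y _.
rewrite !cut_coverP ![y \in _ :\: _]in_setD.
have nA (S1 S2 : {set G}) :
    (y \in nbhd (S1 :\: nbhd S2)) ==> (y \in nbhd S1) && (y \notin S2).
  apply/implyP => h; rewrite (subsetP (nbhdS (subsetDl _ _)) _ h).
  case/nbhdP: h => z; rewrite inE => /andP[zn _] zy; apply: contra zn => yS.
  by apply/nbhdP; exists y => //; rewrite adj_sym.
have nAB : ~~ ((y \in A) && (y \in B)).
  by apply/negP => /andP[yA]; rewrite (disjointFr dAB yA).
move: nAB (nA S S') (nA S' S).
move: (introT implyP (subsetP sA y)) (introT implyP (subsetP sB y)).
rewrite -/S -/S'; case: (y \in A); case: (y \in B) => //; case: (y \in S);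
by case: (y \in S') => //; do 4!case: (y \in _).
Qed.

End Covers.

(** * Existence of branch-decompositions *)

Section Heap.
Variable m : nat.

(* The binary heap 1, ..., 2m + 1 with an extra root 0 above 1: its leaves are
   0 and m + 1, ..., 2m + 1. *)
Definition heap_adj : rel 'I_(m.+1.*2) :=
  fun i j => (i != j) && ((i./2 == j :> nat) || (j./2 == i :> nat)).

Lemma heap_sym : symmetric heap_adj.
Proof. by move=> i j; rewrite /heap_adj /= eq_sym orbC. Qed.

Lemma heap_irrefl : irreflexive heap_adj.
Proof. by move=> i; rewrite /heap_adj /= eqxx. Qed.

Definition heap := SGraph heap_sym heap_irrefl.

Lemma heap_connected : connected_on [set: heap].
Proof.
have h0 : 0 < m.+1.*2 by lia.
pose o : heap := Ordinal h0.
split; first by apply/set0Pn; exists o; rewrite inE.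
pose e := [rel u v : heap | [&& u \in [set: heap], v \in [set: heap] & u -- v]].
have csym : connect_sym e.
  by apply: sym_connect_sym => u v; rewrite /= !inE; apply: heap_sym.
have up (n : nat) : forall i : heap, i <= n -> connect e i o.
  elim: n => [|n IH] i le.
    suff -> : i = o by [].
    by apply: val_inj => /=; move: le; rewrite leqn0 => /eqP.
  have [i0|i0] := posnP (nat_of_ord i).
    by have -> : i = o by apply: val_inj.
  have hi : i./2 < m.+1.*2 by have := ltn_ord i; lia.
  apply: connect_trans (IH (Ordinal hi) _); last by rewrite /=; lia.
  apply: connect1; rewrite /= !inE /= /heap_adj /= eqxx andbT -val_eqE /=; lia.
move=> s t _ _; apply: connect_trans (up s s (leqnn _)) _.
by rewrite csym; apply: up (leqnn _).
Qed.

(* The two neighbours on a cycle of its largest vertex i would both be i./2. *)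
Lemma heap_acyclic : acyclic heap.
Proof.
move=> c /andP[cc uc]; rewrite ltnNge; apply/negP => sc.
have [x xc] : exists x, x \in c by case: c sc {cc uc} => // x c _; exists x; rewrite mem_head.
case: (@arg_maxnP _ x (mem c) val xc) => i ic imax.
have lower (j : heap) : j \in c -> i -- j -> i./2 = j :> nat.
  move=> jc /andP[ne] /orP[/eqP//|/eqP ji]; have := imax j jc; move: ne.
  rewrite -val_eqE /=; lia.
case: (rot_to ic) => n s rc.
have uis : uniq (i :: s) by rewrite -rc rot_uniq.
have cis : cycle (@adj heap) (i :: s) by rewrite -rc rot_cycle.
have sis : size (i :: s) = size c by rewrite -rc size_rot.
have mis j : j \in s -> j \in c by move=> js; rewrite -(mem_rot n) rc inE js orbT.
case/lastP: s {rc} uis cis sis mis => [|s z] /=; first by move=> _ _ h; rewrite -h in sc.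
case: s => [|y s]; first by move=> _ _ h; rewrite -h in sc.
rewrite /= !rcons_path !last_rcons => /and3P[_ + _] /and3P[iy _ zi] _ mis.
have ey := lower y (mis y _) iy; have ez := lower z (mis z _).
rewrite adj_sym in ez; suff -> : y = z by rewrite mem_rcons mem_head.
by apply: val_inj => /=; rewrite -ey ?mem_head // -ez // !inE mem_rcons mem_head ?orbT.
Qed.

(** An inner [i] has neighbours [i./2], [i.*2] and [i.*2.+1]. Beyond [m] only [i./2] is in range,
    and 0, its own half and double, has the single neighbour 1. *)
Lemma heap_deg (i : heap) : deg i = if (i == 0 :> nat) || (m < i) then 1 else 3.
Proof.
have hi := ltn_ord i.
have h1 : i./2 < m.+1.*2 by lia.
case: ifPn => [h|].
  have [i0|i0] := posnP (nat_of_ord i).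
    have h2 : 1 < m.+1.*2 by lia.
    rewrite /deg (_ : [set _ | _] = [set (Ordinal h2 : heap)]) ?cards1 //.
    by apply/setP => j; rewrite !inE /= /heap_adj -!val_eqE /= i0 /=; have := ltn_ord j; lia.
  rewrite /deg (_ : [set _ | _] = [set (Ordinal h1 : heap)]) ?cards1 //.
  by apply/setP => j; rewrite !inE /= /heap_adj -!val_eqE /=; have := ltn_ord j; lia.
move=> h; have h2 : i.*2 < m.+1.*2 by lia.
have h3 : i.*2.+1 < m.+1.*2 by lia.
rewrite /deg (_ : [set _ | _] =
  (Ordinal h1 : heap) |: [set (Ordinal h2 : heap); (Ordinal h3 : heap)]).
  by rewrite cardsU1 cards2 !inE -!val_eqE /=; lia.
by apply/setP => j; rewrite !inE /= /heap_adj -!val_eqE /=; lia.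
Qed.

Lemma heap_subcubic : subcubic_tree heap.
Proof.
split; first by split; [exact: heap_connected|exact: heap_acyclic].
by move=> i; rewrite heap_deg; case: ifP.
Qed.

Lemma heap_card_leaf : #|{: {i : heap | leaf i}}| = m.+2.
Proof.
rewrite card_sig.
have eqm : [pred i : heap | leaf i] =i [pred i : 'I_(m.+1.*2) | (i == 0 :> nat) || (m < i)].
  by move=> i; rewrite !inE /leaf heap_deg; case: ifP.
rewrite (eq_card eqm) -sum1_card.
rewrite -(big_mkord (fun i => (i == 0) || (m < i)) (fun=> 1)).
(* The range is cut at 1 and at [m.+1]: the leaf 0, the inner vertices, the last [m.+1] leaves. *)
rewrite (big_cat_nat (n := 1)) //= big_mkcond big_nat1 /=.
rewrite (big_cat_nat (n := m.+1)) /=; [|lia..].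
rewrite big_nat_cond big_pred0 ?add0n; last by move=> i; lia.
rewrite big_nat_cond (eq_bigl (fun i => (m.+1 <= i < m.+1.*2) && true)); last by move=> i; lia.
rewrite -big_nat_cond sum_nat_const_nat; lia.
Qed.

End Heap.

(** The heap with [m = #|G|.-2] has exactly [#|G|] leaves. This excludes the default value of
    [mmw]. *)
Lemma branch_decomposition_exists (G : sgraph) : 1 < #|G| ->
  exists (T : sgraph) (L : {t : T | leaf t} -> G), branch_decomposition L.
Proof.
move=> G2; have eG : #|{: {i : heap #|G|.-2 | leaf i}}| = #|G|.
  by rewrite heap_card_leaf; lia.
exists (heap #|G|.-2), (fun l => enum_val (cast_ord eG (enum_rank l))).
split; first exact: heap_subcubic.
exists (fun x => enum_val (cast_ord (esym eG) (enum_rank x))) => x.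
  by rewrite enum_valK cast_ordK enum_rankK.
by rewrite enum_valK cast_ordKV enum_rankK.
Qed.

(** * From branch-decompositions to tree-representations *)

(** If all vertices were leaves, one vertex and its only neighbour would be the whole tree. A root
    that is no leaf gives every leaf a parent edge. *)
Lemma subcubic_inner (T : sgraph) : subcubic_tree T -> 2 < #|T| ->
  exists r : T, ~~ leaf r.
Proof.
move=> [[[/set0Pn[r _] cT] _] _] T3; apply: contrapT => nex.
have lf (s : T) : leaf s by apply: contrapT => /negP h; apply: nex; exists s.
have /cards1P[v ev] := lf r; have /cards1P[z ez] := lf v.
have rv : r -- v by have := set11 v; rewrite -ev inE.
have ze : z = r by apply/esym/eqP; rewrite -in_set1 -ez inE adj_sym.
suff /subset_leq_card : [set: T] \subset [set r; v].
  rewrite cardsT cards2 leqNgt => /negP; apply.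
  by apply: leq_ltn_trans T3; case: (r != v).
apply/subsetP => u _; have /connectP[l pl ->] := cT r u (in_setT _) (in_setT _).
pose e := [rel s t : T | [&& s \in [set: T], t \in [set: T] & s -- t]].
suff closed2 x : path e x l -> x \in [set r; v] -> last x l \in [set r; v].
  by apply: closed2 pl (set21 r v).
elim: l {pl} x => //= y l IH x /andP[/and3P[_ _ xy] pl] xrv; apply: IH pl _.
move: xrv; rewrite !inE => /orP[]/eqP ex.
  have : y \in [set u | r -- u] by rewrite inE -ex.
  by rewrite ev inE => ->; rewrite orbT.
have : y \in [set u | v -- u] by rewrite inE -ex.
by rewrite ez inE ze => ->.
Qed.

(** * Subtrees assembled from the covers of the cuts at tree edges *)

Section Representation.
Variables (G T : sgraph) (q : rooting T) (lf : G -> T).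
Hypotheses (lf_inj : injective lf) (lf_leaf : forall x, leaf (lf x)).
Hypothesis depth_lf : forall x, 0 < depth q (lf x).
Local Notation p := (parent q).
Local Notation d := (depth q).
Implicit Types (u v w : T) (x y : G).

Definition below w : {set G} := [set x | anc q w (lf x)].

Hypothesis cover2 : forall w, 0 < d w -> #|tight_cover (below w)| <= 2.

(* Each vertex x of G lives on the tree edges {w, parent w} with [carries x w];
   the leaf edge is added in order that isolated vertices get one. *)
Definition carries x w := (0 < d w) && ((x \in tight_cover (below w)) || (w == lf x)).

Definition region x : {set T} :=
  [set u | [exists w, carries x w && ((u == w) || (u == p w))]].

Lemma carries_leaf x : carries x (lf x).
Proof. by rewrite /carries depth_lf eqxx orbT. Qed.

Lemma carries_depth x w : carries x w -> 0 < d w.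
Proof. by case/andP. Qed.

Lemma below_mono w : 0 < d w -> below w \subset below (p w).
Proof. by move=> dw; apply/subsetP => x; rewrite !inE; apply: anc_parent. Qed.

Lemma below_sibling w w' : 0 < d w -> 0 < d w' -> p w = p w' -> w != w' ->
  [disjoint below w & below w'].
Proof.
move=> dw dw' e ne; apply/pred0P => x /=; apply/negP; rewrite !inE => /andP[h h'].
case/eqP: ne; apply: anc_inj h h' _.
by rewrite (depth_parent dw) (depth_parent dw') e.
Qed.

(** Outside a cut, being covered means being adjacent to its [tight] set, which grows from [w] to
    [p w]. *)
Lemma carries_up x w : carries x w -> x \notin below (p w) -> carries x (p w).
Proof.
move=> /andP[dw cw] nb.
have nw : x \notin below w by apply: contra nb; apply/subsetP/below_mono.
apply/andP; split.
  by rewrite lt0n; apply: contra nb => /eqP/anc_root h; rewrite inE.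
move: cw; rewrite !tight_coverP (negPf nb) (negPf nw) => /orP[h|/eqP h].
  apply/orP; left; apply: subsetP h; apply: nbhdS.
  exact: tight_mono (below_mono dw).
by move: nw; rewrite inE h anc_refl.
Qed.

(** Inside a cut, being covered means missing its [tight] set, which shrinks from [p w] to [w]. *)
Lemma carries_down x w : carries x (p w) -> 0 < d w -> x \in below w -> carries x w.
Proof.
move=> /andP[_ cw] dw xw; rewrite /carries dw /=.
have xpw := subsetP (below_mono dw) _ xw.
move: cw; rewrite !tight_coverP xw xpw => /orP[h|/eqP h].
  by apply/orP; left; apply: contra h; apply/subsetP/tight_mono/below_mono.
move: xw; rewrite inE -h => /anc_depth; have := depth_parent dw.
lia.
Qed.

(** A neighbour of the [tight] set below [w'] is not in the [tight] set below its sibling [w], by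
    [tight_disjoint]. *)
Lemma carries_sibling x w w' : carries x w' -> x \notin below w' -> 0 < d w ->
  p w = p w' -> x \in below w -> carries x w.
Proof.
move=> /andP[dw' cw'] nw' dw e xw; rewrite /carries dw tight_coverP xw /=.
move: cw'; rewrite tight_coverP (negPf nw') => /orP[h|/eqP h].
  apply/orP; left; apply: contraL h; apply: tight_disjoint.
  by apply: below_sibling => //; apply: contraNneq nw' => <-.
by move: nw'; rewrite inE h anc_refl.
Qed.

Lemma region_bot x w : carries x w -> w \in region x.
Proof. by move=> h; rewrite inE; apply/existsP; exists w; rewrite h eqxx. Qed.

Lemma region_parent x w : carries x w -> p w \in region x.
Proof. by move=> h; rewrite inE; apply/existsP; exists w; rewrite h eqxx orbT. Qed.

(** A region contains no tree edge beyond those carried: if other carried edges bring [w] and [p w]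
    into it, the three transfer lemmas pass from one of them to [w]. *)
Lemma region_edge x w : 0 < d w -> w \in region x -> p w \in region x -> carries x w.
Proof.
move=> dw; rewrite inE => /existsP[w' /andP[cw' /orP[]/eqP ew']]; first by rewrite ew'.
rewrite inE => /existsP[w'' /andP[cw'' ew'']].
have [xw|nxw] := boolP (x \in below w); last first.
  by rewrite ew'; apply: carries_up => //; rewrite -ew'.
case/orP: ew'' => /eqP ew''; first by apply: carries_down => //; rewrite ew''.
have [xw''|nxw''] := boolP (x \in below w''); last exact: carries_sibling cw'' _ _ _ _.
suff -> : w = w'' by [].
move: xw xw''; rewrite !inE => h h''; apply: anc_inj h h'' _.
by rewrite (depth_parent dw) (depth_parent (carries_depth cw'')) ew''.
Qed.

Lemma below_leaf x : below (lf x) = [set x].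
Proof.
apply/setP => y; rewrite !inE; apply/idP/eqP => [h|->]; last exact: anc_refl.
exact: lf_inj (anc_leaf (lf_leaf x) (depth_lf x) h).
Qed.

(** The added leaf edges are harmless: the cover at a leaf has at most one vertex, which leaves room
    for the vertex of that leaf. *)
Lemma carries_card w : 0 < d w -> #|[set x | carries x w]| <= 2.
Proof.
move=> dw; have [/existsP[y /eqP ew]|nex] := boolP [exists y, w == lf y].
  apply: (@leq_trans #|y |: tight_cover (below w)|).
    apply: subset_leq_card; apply/subsetP => x; rewrite in_set in_setU1 => /andP[_ /orP[->|]].
      by rewrite orbT.
    by rewrite ew => /eqP/lf_inj ->; rewrite eqxx.
  have := tight_cover_leq_card (below w); rewrite ew below_leaf cards1 cardsU1.
  by case: (_ \notin _) => /=; lia.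
apply: leq_trans (cover2 dw); apply: subset_leq_card; apply/subsetP => x.
rewrite in_set => /andP[_ /orP[//|h]]; case/negP: nex; by apply/existsP; exists x.
Qed.

Lemma region_width : tr_width region <= 2.
Proof.
apply/bigmax_leqP => -[s t] /= st.
have [[ds e]|[dt e]] := adj_rooting q st.
  apply: leq_trans (carries_card ds); apply: subset_leq_card; apply/subsetP => x.
  rewrite !inE subUset !sub1set => /andP[sx tx]; apply: region_edge; rewrite ?e //.
apply: leq_trans (carries_card dt); apply: subset_leq_card; apply/subsetP => x.
by rewrite !inE subUset !sub1set => /andP[sx tx]; apply: region_edge; rewrite ?e.
Qed.

Lemma region_link x w : carries x w ->
  connect (induced (region x)) w (p w) /\ connect (induced (region x)) (p w) w.
Proof.
move=> cw; rewrite [X in _ /\ is_true X](sym_connect_sym (@induced_sym _ _)).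
suff : connect (induced (region x)) w (p w) by [].
apply: connect1; rewrite /induced /= region_bot // region_parent //.
exact: adj_parent (carries_depth cw).
Qed.

Lemma region_connect_below x w : carries x w -> x \in below w ->
  connect (induced (region x)) w (lf x).
Proof.
move: {2}(d (lf x) - d w) (leqnn (d (lf x) - d w)) => n.
elim: n w => [|n IH] w le cw; rewrite inE => aw;
  have [->|ne] := eqVneq (lf x) w; try exact: connect0; have lt := anc_proper aw ne.
  lia.
have [w' [dw' e aw']] := anc_child aw ne.
have cw' : carries x w' by apply: carries_down; rewrite ?e ?inE.
rewrite -e; apply: connect_trans (region_link cw').2 (IH w' _ cw' _); last by rewrite inE.
by have := depth_parent dw'; rewrite e; lia.
Qed.

(** Climb by [carries_up] until the parent is an ancestor of [lf x], then turn down towards [lf x]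
    by [carries_sibling]. *)
Lemma region_connect x w : carries x w -> connect (induced (region x)) w (lf x).
Proof.
move: {2}(d w) (leqnn (d w)) => n; elim: n w => [|n IH] w le cw.
  by have := carries_depth cw; lia.
have dw := carries_depth cw; have dpw := depth_parent dw.
have [xw|nxw] := boolP (x \in below w); first exact: region_connect_below.
apply: connect_trans (region_link cw).1 _.
have [xpw|nxpw] := boolP (x \in below (p w)); last first.
  by apply: IH (carries_up cw nxpw); lia.
have [<-|ne] := eqVneq (lf x) (p w); first exact: connect0.
move: xpw; rewrite inE => /anc_child/(_ ne)[w' [dw' e aw']].
have xw' : x \in below w' by rewrite inE.
have cw' := carries_sibling cw nxw dw' e xw'.
by rewrite -e; apply: connect_trans (region_link cw').2 (region_connect_below cw' xw').
Qed.

Lemma region_subtree x : nontrivial_subtree (region x).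
Proof.
have cl := carries_leaf x; split; last first.
  exists (lf x), (p (lf x)); split; [exact: region_bot|exact: region_parent|].
  exact: adj_parent.
split; first by apply/set0Pn; exists (lf x); apply: region_bot.
have toL s : s \in region x -> connect (induced (region x)) s (lf x).
  rewrite inE => /existsP[w /andP[cw /orP[]/eqP->]]; first exact: region_connect.
  exact: connect_trans (region_link cw).2 (region_connect cw).
move=> s t sx tx; apply: connect_trans (toL s sx) _.
by have := toL t tx; rewrite (sym_connect_sym (@induced_sym _ _)).
Qed.

(* Climbing from the leaf of x, every edge separating it from y is covered by x,
   lest the two regions meet. *)
Lemma carries_separating x y : x -- y -> region x :&: region y = set0 ->
  forall w, x \in below w -> y \notin below w -> carries x w.
Proof.
move=> xy dis w; move: {2}(d (lf x) - d w) (leqnn (d (lf x) - d w)) => n.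
elim: n w => [|n IH] w le xw yw; move: (xw); rewrite inE => aw;
  have [<-|ne] := eqVneq (lf x) w; try exact: carries_leaf; have lt := anc_proper aw ne.
  lia.
have [w' [dw' e aw']] := anc_child aw ne; have dpw' := depth_parent dw'.
have yw' : y \notin below w'.
  by apply: contra yw; rewrite -e; apply/subsetP/below_mono.
have xw' : x \in below w' by rewrite inE.
have cw' : carries x w' by apply: IH xw' yw'; rewrite e in dpw'; lia.
have dw : 0 < d w by rewrite lt0n; apply: contra yw => /eqP/anc_root h; rewrite inE.
have /orP[h|h] := tight_cover_edge xw yw xy; first by rewrite /carries dw h.
have cy : carries y w by rewrite /carries dw h.
have wx : w \in region x by rewrite -e region_parent.
by move/setP: dis => /(_ w); rewrite in_setI in_set0 wx region_bot.
Qed.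

(** If the regions are disjoint, take a shallowest [w] above [lf x] but not above [lf y]. Then [p w]
    is above both and has a child [w'] above [lf y] only. As [x] is carried at [w] and [y] at [w'],
    both regions contain [p w]. *)
Lemma region_meet x y : x -- y -> region x :&: region y != set0.
Proof.
move=> xy; apply/eqP => dis.
have ne : x != y by apply: contraTneq xy => ->; rewrite adj_irrefl.
pose P w := (x \in below w) && (y \notin below w).
have P0 : P (lf x) by rewrite /P below_leaf !inE eqxx eq_sym.
case: (@arg_minnP _ (lf x) P d P0) => w /andP[xw yw] wmin.
have cw := carries_separating xy dis xw yw; have dw := carries_depth cw.
have dpw := depth_parent dw; have xpw := subsetP (below_mono dw) _ xw.
have ypw : y \in below (p w).
  by apply: contraT => yp; have := wmin (p w); rewrite /P xpw yp => /(_ isT); lia.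
have yl : lf y != p w.
  apply: contraTneq xpw => <-; by rewrite below_leaf inE.
move: ypw; rewrite inE => /anc_child/(_ yl)[w' [dw' e aw']].
have yw' : y \in below w' by rewrite inE.
have xw' : x \notin below w'.
  have ww' : w' != w by apply: contraNneq yw => <-.
  by rewrite (disjointFl (below_sibling dw' dw e ww')).
have dis' : region y :&: region x = set0 by rewrite setIC.
rewrite adj_sym in xy; have cw' := carries_separating xy dis' yw' xw'.
have wy : p w \in region y by rewrite -e region_parent.
by move/setP: dis => /(_ (p w)); rewrite in_setI in_set0 wy region_parent.
Qed.

End Representation.

Lemma tree_representation_exists (G T : sgraph) (L : {t : T | leaf t} -> G) :
  2 < #|G| -> branch_decomposition L -> bd_width L <= 2 ->
  exists R : G -> {set T}, tree_representation R /\ tr_width R <= 2.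
Proof.
move=> G3 [scT [L' LK L'K]] wL; pose lf x := val (L' x).
have lf_inj : injective lf by move=> x y /val_inj/(can_inj L'K).
have lf_leaf x : leaf (lf x) by exact: valP (L' x).
have [r nr] : exists r : T, ~~ leaf r.
  by apply: subcubic_inner => //; apply: leq_trans G3 (leq_card lf lf_inj).
have [q er] := tree_rooting r scT.1.
have dl x : 0 < depth q (lf x).
  rewrite lt0n; apply: contraNneq nr => /depth0_root; rewrite er => <-.
  exact: lf_leaf.
have c2 w : 0 < depth q w -> #|tight_cover (below q lf w)| <= 2.
  move=> dw; apply: leq_trans (tight_cover_card _) _; apply: leq_trans wL.
  (* The vertices below [w] form a side of the cut at its parent edge, so [bd_width] bounds the
     cover. *)
  have -> : below q lf w = bd_side L w (parent q w).
    apply/setP => x; rewrite inE -(connect_del_parent _ dw).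
    apply/idP/imsetP => [h|[l]]; first by exists (L' x); rewrite ?inE ?L'K.
    by rewrite inE => h ->; rewrite /lf LK.
  apply: (@leq_bigmax_cond _ _ (fun e : T * T => max_cut_matching (bd_side L e.1 e.2))
     (w, parent q w)).
  exact: adj_parent.
exists (region q lf); split; last exact: region_width.
split=> // [x|x y]; first exact: region_subtree.
exact: region_meet.
Qed.

(** * Routing through the two new vertices *)

Lemma edge_set_card (G T : sgraph) (R : G -> {set T}) (s t : T) : s -- t ->
  #|[set x : G | [set s; t] \subset R x]| <= tr_width R.
Proof.
move=> st.
exact: (@leq_bigmax_cond _ _
  (fun e : T * T => #|[set x : G | [set e.1; e.2] \subset R x]|) (s, t)).
Qed.

Lemma edge_sub_pair (G T : sgraph) (R : G -> {set T}) (s t : T) (u v x : G) :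
  tr_width R <= 2 -> s -- t -> u != v -> [set s; t] \subset R u ->
  [set s; t] \subset R v -> [set s; t] \subset R x -> x = u \/ x = v.
Proof.
move=> w2 st uv su sv sx; apply: contrapT => /not_orP[/eqP xu /eqP xv].
have : #|x |: [set u; v]| <= 2.
  apply: leq_trans (leq_trans (edge_set_card R st) w2); apply: subset_leq_card.
  by apply/subsetP => y; rewrite !inE => /or3P[]/eqP->.
by rewrite cardsU1 cards2 !inE (negPf xu) (negPf xv) uv.
Qed.

Section Rerouting.
Variables (G : sgraph) (a b : G) (T : sgraph) (R : ext_graph a b -> {set T}).
Hypothesis neq_ab : a != b.
Hypotheses (repR : tree_representation R) (width2 : tr_width R <= 2).
Local Notation c := (inr true : ext_graph a b).
Local Notation d := (inr false : ext_graph a b).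
Local Notation old x := (inl x : ext_graph a b).

(* Adding W to both [R a] and [R b] keeps the width at most 2 if every edge of W
   is free of the vertices of G other than a and b. *)
Lemma good_of_subtree (W : {set T}) :
  nontrivial_subtree W -> R (old a) :&: W != set0 -> R (old b) :&: W != set0 ->
  (forall (s t : T) (x : G), s -- t -> [set s; t] \subset W ->
     [set s; t] \subset R (old x) -> x = a \/ x = b) ->
  good a b.
Proof.
move=> [cW [s0 [t0 [s0W t0W st0]]]] iaW ibW Wfree.
have [scT subR meetR] := repR; have tT := scT.1.
have e0W : [set s0; t0] \subset W by rewrite subUset !sub1set s0W.
pose R' (x : G) := if x \in [set a; b] then R (old x) :|: W else R (old x).
have iW x : x \in [set a; b] -> R (old x) :&: W != set0.
  by rewrite !inE => /orP[]/eqP->.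
have subR' x : R (old x) \subset R' x by rewrite /R'; case: ifP; rewrite ?subsetUl.
have aR' : W \subset R' a by rewrite /R' !inE eqxx subsetUr.
have bR' : W \subset R' b by rewrite /R' !inE eqxx orbT subsetUr.
have w2 : tr_width R' <= 2.
  apply/bigmax_leqP => -[s t] /= st.
  have [stW|nstW] := boolP ([set s; t] \subset W).
    apply: (@leq_trans #|[set a; b]|); last by rewrite cards2; case: (_ != _).
    apply: subset_leq_card; apply/subsetP => x; rewrite inE /R'; case: ifP => // nx.
    by move/(Wfree s t x st stW) => [] xe; rewrite xe !inE eqxx ?orbT in nx.
  apply: leq_trans (leq_trans (edge_set_card R st) width2).
  rewrite -(card_imset _ (@inl_inj G bool)); apply: subset_leq_card.
  apply/subsetP => _ /imsetP[x + ->]; rewrite !inE /R'; case: ifP => // xab h.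
  (* An edge not inside [W] gains no subtree: it lies in the enlarged one only if it lay in the old
     one. *)
  have := edge_setU tT (subR (old x)).1 cW (iW x xab) st h.
  by rewrite (negPf nstW) orbF.
exists T, R'; split.
- split=> // [x|u v uv].
    rewrite /R'; case: ifP => xab //; split.
      by apply: connected_onU cW (iW x xab); case: (subR (old x)).
    by exists s0, t0; rewrite !inE s0W t0W !orbT.
  (* The edge [ab] is absent from [ext_graph], so its ends have to meet in [W]. *)
  have [/setP euv|ne] := eqVneq [set u; v] [set a; b].
    apply/set0Pn; exists s0; rewrite inE.
    have abW x : x \in [set a; b] -> s0 \in R' x.
      by rewrite !inE => /orP[]/eqP->; [exact: subsetP aR' _ s0W|exact: subsetP bR' _ s0W].
    by rewrite !abW // -euv !inE eqxx ?orbT.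
  have /meetR/set0Pn[z /setIP[zu zv]] : old u -- old v by rewrite /= /del_edge /= uv ne.
  by apply/set0Pn; exists z; rewrite inE !(subsetP (subR' _)).
(* [good] asks for width exactly 2; the edge [s0 t0] of [W] attains it. *)
- apply/eqP; rewrite eqn_leq w2; apply: leq_trans (edge_set_card R' st0).
  apply: (@leq_trans #|[set a; b]|); first by rewrite cards2 neq_ab.
  apply: subset_leq_card; apply/subsetP => x; rewrite !inE => /orP[]/eqP->.
    exact: subset_trans e0W aR'.
  exact: subset_trans e0W bR'.
- exists s0, t0; split=> //; [exact: subset_trans e0W aR'|exact: subset_trans e0W bR'].
Qed.

(** The single edge serves as [W]; width 2 leaves no room on it beyond [u] and [v]. *)
Lemma good_of_edge (s t : T) (u v : ext_graph a b) : s -- t -> u != v ->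
  [set s; t] \subset R u -> [set s; t] \subset R v ->
  (forall x : G, old x = u \/ old x = v -> x = a \/ x = b) ->
  R (old a) :&: [set s; t] != set0 -> R (old b) :&: [set s; t] != set0 -> good a b.
Proof.
move=> st uv su sv old_uv ia ib; apply: (good_of_subtree _ ia ib).
  by split; [exact: connected_edge|exists s, t; rewrite set21 set22].
move=> s' t' x st' sub' sx; apply: old_uv.
suff e : [set s'; t'] = [set s; t].
  by rewrite e in sx; apply: edge_sub_pair st uv su sv sx.
apply/eqP; rewrite eqEcard sub' !cards2.
by case: (s' =P t') st' => [->|_ _]; [rewrite adj_irrefl|case: (_ != _)].
Qed.

Lemma meet_new (x : G) (i : bool) : x \in [set a; b] ->
  R (old x) :&: R (inr i) != set0.
Proof. by move=> xab; case: repR => _ _ m; apply: (m (old x) (inr i)). Qed.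

(** Take [W = R c :&: R d]: it meets [R a] and [R b] by Helly, and its edges are full with [c] and
    [d]. *)
Lemma good_of_shared_edge_new (s t : T) : s -- t ->
  [set s; t] \subset R c -> [set s; t] \subset R d -> good a b.
Proof.
move=> st sc sd; have [scT subR _] := repR; have tT := scT.1.
have conR x := (subR x).1.
have scd : [set s; t] \subset R c :&: R d by rewrite subsetI sc.
have icd : R c :&: R d != set0.
  by apply/set0Pn; exists s; rewrite (subsetP scd) ?set21.
have iW x : x \in [set a; b] -> R (old x) :&: (R c :&: R d) != set0.
  move=> xab; have [v [vx vc vd]] := subtree_helly tT (conR (old x)) (conR c) (conR d)
    (meet_new true xab) (meet_new false xab) icd.
  by apply/set0Pn; exists v; rewrite !inE vx vc.
apply: (@good_of_subtree (R c :&: R d)).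
- split; first exact: connected_onI.
  by exists s, t; split=> //; apply: (subsetP scd); rewrite ?set21 ?set22.
- by apply: iW; rewrite set21.
- by apply: iW; rewrite set22.
move=> s' t' x st'; rewrite subsetI => /andP[sc' sd'] sx.
by have [] := edge_sub_pair width2 st' (isT : c != d) sc' sd' sx.
Qed.

(** Helly gives a vertex of [R u :&: R u'] in [R v] and one in [R v']. If they differ, this
    connected intersection contains an edge. *)
Lemma common_vertex_or_edge (u u' v v' : ext_graph a b) :
  R u :&: R u' != set0 ->
  R u :&: R v != set0 -> R u :&: R v' != set0 ->
  R u' :&: R v != set0 -> R u' :&: R v' != set0 ->
  (exists z, [/\ z \in R u, z \in R u', z \in R v & z \in R v']) \/
  (exists s t, [/\ s -- t, [set s; t] \subset R u & [set s; t] \subset R u']).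
Proof.
move=> iuu iuv iuv' iu'v iu'v'; have [scT subR _] := repR; have tT := scT.1.
have conR x := (subR x).1.
have [z [zu zu' zv]] := subtree_helly tT (conR u) (conR u') (conR v) iuu iuv iu'v.
have [y [yu yu' yv']] := subtree_helly tT (conR u) (conR u') (conR v') iuu iuv' iu'v'.
have [e|ne] := eqVneq z y; first by left; exists z; split; rewrite // e.
have cI := connected_onI tT (conR u) (conR u') iuu.
have zI : z \in R u :&: R u' by rewrite inE zu.
have yI : y \in R u :&: R u' by rewrite inE yu.
have [t tI zt] := connected_nbr cI zI yI ne.
right; exists z, t; move: tI; rewrite inE => /andP[tu tu'].
by rewrite !subUset !sub1set zu zu' tu tu'.
Qed.

Lemma subtree_nbr (u : ext_graph a b) (v : T) : v \in R u ->
  exists2 n, n \in R u & v -- n.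
Proof.
move=> vu; have [_ subR _] := repR; have [cu [s [t [su tu st]]]] := subR u.
have [vs|ne] := eqVneq v s; first by exists t; rewrite // vs.
exact: connected_nbr cu vu su ne.
Qed.

(* Around a vertex common to the four subtrees, each of them uses one of at most
   three edges, so two of them share an edge. *)
Lemma good_of_common_vertex (v : T) : v \in R (old a) -> v \in R (old b) ->
  v \in R c -> v \in R d -> good a b.
Proof.
move=> va vb vc vd.
have [na naR vna] := subtree_nbr va; have [nb nbR vnb] := subtree_nbr vb.
have [nc ncR vnc] := subtree_nbr vc; have [nd ndR vnd] := subtree_nbr vd.
have sub u n : v \in R u -> n \in R u -> [set v; n] \subset R u.
  by move=> vu nu; rewrite subUset !sub1set vu.
have ia n : R (old a) :&: [set v; n] != set0.
  by apply/set0Pn; exists v; rewrite !inE va eqxx.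
have ib n : R (old b) :&: [set v; n] != set0.
  by apply/set0Pn; exists v; rewrite !inE vb eqxx.
have shared n (u u' : ext_graph a b) : v -- n -> u != u' ->
    v \in R u -> n \in R u -> v \in R u' -> n \in R u' ->
    (forall x : G, old x = u \/ old x = u' -> x = a \/ x = b) -> good a b.
  move=> vn uu' vu nu vu' nu' h.
  by apply: (good_of_edge vn uu' (sub _ _ vu nu) (sub _ _ vu' nu') h).
have [e|nab] := eqVneq na nb.
  apply: (shared na (old a) (old b)) => //; rewrite ?e //.
  by move=> x [[->]|[->]]; [left|right].
have [e|ncd] := eqVneq nc nd.
  apply: (@good_of_shared_edge_new v nc) => //; apply: sub; rewrite // e //.
(* An edge shared by [a] and [c] is full, and its end [v] lies in [R b], so [b] can be extended
   along it. The other mixed pairs are alike. *)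
have [e|nac] := eqVneq na nc.
  by apply: (shared na (old a) c) => //; rewrite ?e // => x [[->]|//]; left.
have [e|nad] := eqVneq na nd.
  by apply: (shared na (old a) d) => //; rewrite ?e // => x [[->]|//]; left.
have [e|nbc] := eqVneq nb nc.
  by apply: (shared nb (old b) c) => //; rewrite ?e // => x [[->]|//]; right.
have [e|nbd] := eqVneq nb nd.
  by apply: (shared nb (old b) d) => //; rewrite ?e // => x [[->]|//]; right.
have [scT _ _] := repR.
(* Four distinct neighbours are too many for degree 1 or 3. *)
have : #|[set na; nb] :|: [set nc; nd]| <= deg v.
  by apply: subset_leq_card; apply/subsetP => x; rewrite !inE => /orP[]/orP[]/eqP->.
rewrite cardsU !cards2 nab ncd disjoint_setI0 ?cards0; last first.
  apply/pred0P => x /=; rewrite !inE; apply/negP => /andP[/orP[]/eqP-> /orP[]];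
    by rewrite ?(negPf nac) ?(negPf nad) ?(negPf nbc) ?(negPf nbd).
by case/orP: (scT.2 v) => /eqP->.
Qed.

(** The 4-cycle [a], [c], [b], [d] of meeting subtrees has a chord [ab] or [cd]. The subtrees of
    that chord share an edge, or all four share a vertex. *)
Lemma good_of_representation : good a b.
Proof.
have aab : a \in [set a; b] by rewrite set21.
have bab : b \in [set a; b] by rewrite set22.
have iac := meet_new true aab; have iad := meet_new false aab.
have ibc := meet_new true bab; have ibd := meet_new false bab.
have [scT subR _] := repR; have conR x := (subR x).1.
have [iab|icd] := subtree_chord scT.1 (conR (old a)) (conR (old b)) (conR c) (conR d)
  iac iad ibc ibd.
  have [[z [za zb zc zd]]|[s [t [st sa sb]]]] :=
    common_vertex_or_edge iab iac iad ibc ibd.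
    exact: good_of_common_vertex za zb zc zd.
  apply: (@good_of_edge s t (old a) (old b)) => //.
  - by move=> x [[->]|[->]]; [left|right].
  - by apply/set0Pn; exists s; rewrite inE set21 (subsetP sa) ?set21.
  - by apply/set0Pn; exists s; rewrite inE set21 (subsetP sb) ?set21.
have ica : R c :&: R (old a) != set0 by rewrite setIC.
have icb : R c :&: R (old b) != set0 by rewrite setIC.
have ida : R d :&: R (old a) != set0 by rewrite setIC.
have idb : R d :&: R (old b) != set0 by rewrite setIC.
have [[z [zc zd za zb]]|[s [t [st sc sd]]]] :=
  common_vertex_or_edge icd ica icb ida idb.
  exact: good_of_common_vertex za zb zc zd.
exact: good_of_shared_edge_new st sc sd.
Qed.

End Rerouting.

Theorem lemma3p7 (G : sgraph) (a b : G) (neq_ab : a != b) (bad_ab : bad a b) :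
  3 <= mmw (ext_graph a b).
Proof.
have cG : 2 < #|ext_graph a b|.
  rewrite /= card_sum card_bool; suff : 0 < #|G| by lia.
  by apply/card_gt0P; exists a.
(* A branch-decomposition exists, so [mmw] is a true minimum and not the default 0. *)
rewrite /mmw; case: pselect => [ex|[]]; last first.
  have [T [L bdL]] := branch_decomposition_exists (ltnW cG).
  by exists (bd_width L); apply/asboolP; exists T, L.
case: ex_minnP => k /asboolP[T [L [bdL <-]]] _; rewrite ltnNge; apply/negP => w2.
have [R [repR wR]] := tree_representation_exists cG bdL w2.
exact: bad_ab (good_of_representation neq_ab repR wR).
Qed.
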